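(* There exist edge lengths for which the number of planar embeddings, up to rigid motions, of the iterated ''caterpillar'' Desargues frameworks with $n$ vertices is of the order of $24^{n/4}\approx(2.21)^n$. That is, there are constants $c,C>0$ such that for every $k\ge 1$ and every caterpillar $C_k$ of $k$ Desargues graphs (with $n=4k+2$ vertices) there is a choice of edge lengths for which the number of embeddings in $\mathbb{R}^2$ up to rigid motions lies between $c\cdot 24^{n/4}$ and $C\cdot 24^{n/4}$.
   Context: A framework $(G,L)$ is a graph $G=(V,E)$, $V=\{1,\dots,n\}$, together with a set $L=\{l_{ij} : ij\in E\}$ of positive real numbers (edge lengths). An embedding (or realization) of $(G,L)$ in $\mathbb{R}^d$ is a map $V\to\mathbb{R}^d$, $i\mapsto p_i$, with $|p_i-p_j|=l_{ij}$ for every $ij\in E$; vertices may coincide and edges may cross. Two embeddings are identified up to rigid motions if one is obtained from the other by an orientation-preserving isometry of $\mathbb{R}^d$ (so an embedding and its mirror image are counted as distinct unless related by such an isometry). The Desargues graph (Desargues framework) is the graph on $6$ vertices $a,b,c,a',b',c'$ whose $9$ edges are those of the two triangles $abc$ and $a'b'c'$ together with $aa',bb',cc'$. A caterpillar $C_k$ of $k$ Desargues graphs is obtained from Desargues graphs $D_1,\dots,D_k$, each with a chosen quadrilateral ($4$-cycle) $Q_i\subset D_i$ of the form $a\,b\,b'\,a'$, by gluing $D_{i+1}$ to $D_i$ (for $1\le i<k$) along one edge, identifying an edge of $Q_i$ with an edge of $Q_{i+1}$, where for $1<i<k$ the edges of $Q_i$ used for gluing to $D_{i-1}$ and to $D_{i+1}$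 are distinct. Thus the quadrilaterals form a planar graph whose dual is a path, and each Desargues graph after the first adds $4$ new vertices, so $n=4k+2$. *)

(* Defs.v *)
From HB Require Import structures.
From mathcomp Require Import all_boot all_order all_algebra.
From mathcomp Require Import all_classical all_reals all_analysis.

Set Implicit Arguments.
Unset Strict Implicit.
Unset Printing Implicit Defensive.

Import Order.TTheory GRing.Theory Num.Theory.
Local Open Scope ring_scope.

(** * Frameworks and their embeddings *)

(* The library norm on ['rV[R]_d] is the sup norm, hence this definition. *)
Definition edist (R : realType) (d : nat) (x y : 'rV[R]_d) : R :=
  Num.sqrt (\sum_(i < d) (x 0 i - y 0 i) ^+ 2).

(* A graph on ['I_n] is a relation [e].  Lengths are given by a function on all
   pairs of vertices, of which only the values on edges are ever used. *)
Definition edge_lengths (R : realType) (n : nat) (e : rel 'I_n)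
    (l : 'I_n -> 'I_n -> R) : Prop :=
  forall i j, e i j -> 0 < l i j /\ l i j = l j i.

Definition embedding (R : realType) (d n : nat) (e : rel 'I_n)
    (l : 'I_n -> 'I_n -> R) (p : 'I_n -> 'rV[R]_d) : Prop :=
  forall i j, e i j -> edist (p i) (p j) = l i j.

Definition isometry (R : realType) (d : nat) (f : 'rV[R]_d -> 'rV[R]_d) : Prop :=
  forall x y, edist (f x) (f y) = edist x y.

Definition orientation_preserving (R : realType) (d : nat)
    (f : 'rV[R]_d -> 'rV[R]_d) : Prop :=
  exists (A : 'M[R]_d) (b : 'rV[R]_d),
    (forall x, f x = x *m A + b) /\ 0 < \det A.

Definition rigid_motion (R : realType) (d : nat)
    (f : 'rV[R]_d -> 'rV[R]_d) : Prop :=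
  isometry f /\ orientation_preserving f.

Definition congruent (R : realType) (d n : nat)
    (p q : 'I_n -> 'rV[R]_d) : Prop :=
  exists2 f : 'rV[R]_d -> 'rV[R]_d, rigid_motion f & forall i, q i = f (p i).

Definition embedding_classes (R : realType) (d n : nat) (e : rel 'I_n)
    (l : 'I_n -> 'I_n -> R) : set (set ('I_n -> 'rV[R]_d)) :=
  [set [set q | embedding e l q /\ congruent p q] | p in [set p | embedding e l p]]%classic.

(* There are finitely many embeddings up to rigid motions, namely [N]. *)
Definition num_embeddings (R : realType) (d n : nat) (e : rel 'I_n)
    (l : 'I_n -> 'I_n -> R) (N : nat) : Prop :=
  (@embedding_classes R d n e l #= `I_N)%card.

(** * The Desargues graph *)

(* [(false, i)], for i = 0, 1, 2, stand for a, b, c and [(true, i)] for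
   a', b', c'. *)
Definition desargues_vertex : finType := (bool * 'I_3)%type.

Definition desargues : rel desargues_vertex := fun u v =>
  ((u.1 == v.1) && (u.2 != v.2)) || ((u.1 != v.1) && (u.2 == v.2)).

(* The edges of the quadrilateral that avoids [(false, m)] and [(true, m)]; the
   quadrilateral a b b' a' is [m = 2]. *)
Definition quad_edges (m : 'I_3) : {set {set desargues_vertex}} :=
  [set E | [exists u, exists v,
     [&& u.2 != m, v.2 != m, desargues u v & E == [set u; v]]]].

(** * Caterpillars of Desargues graphs *)

(* [D i] places the [i]-th Desargues graph (counted from 0) in the graph [e],
   [m i] selects its quadrilateral, and [S i] is the edge along which the graphs
   [i] and [i.+1] are glued.  Values of [D] and [m] at [i >= k], and of [S] at
   [i.+1 >= k], are irrelevant. *)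
Record caterpillar_data (k n : nat) (e : rel 'I_n)
    (D : nat -> desargues_vertex -> 'I_n) (m : nat -> 'I_3)
    (S : nat -> {set 'I_n}) : Prop := CaterpillarData {
  cat_inj : forall i, (i < k)%N -> injective (D i);
  cat_vertices : forall x : 'I_n,
    exists2 i, (i < k)%N & exists u, x = D i u;
  cat_edges : forall x y : 'I_n,
    e x y <-> exists2 i, (i < k)%N &
                exists u v, [/\ desargues u v, x = D i u & y = D i v];
  cat_glue_left : forall i, (i.+1 < k)%N ->
    exists2 E, E \in quad_edges (m i) & S i = [set D i u | u in E];
  cat_glue_right : forall i, (i.+1 < k)%N ->
    exists2 E, E \in quad_edges (m i.+1) & S i = [set D i.+1 u | u in E];
  (* nothing but the two ends of [S i] is identified when [D i.+1] is added *)
  cat_meet : forall i, (i.+1 < k)%N ->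
    (\bigcup_(j < i.+1) [set D j u | u in [set: desargues_vertex]])
      :&: [set D i.+1 u | u in [set: desargues_vertex]] = S i;
  cat_distinct : forall i, (i.+2 < k)%N -> S i != S i.+1
}.

Definition caterpillar (k n : nat) (e : rel 'I_n) : Prop :=
  exists D m S, @caterpillar_data k n e D m S.

(* Main.v *)
Require Import Defs.
From HB Require Import structures.
From mathcomp Require Import all_boot all_order all_algebra.
From mathcomp Require Import all_classical all_reals all_analysis.
From mathcomp Require Import ring lra zify.
Import Defs.

(** One copy of the Desargues graph can be given lengths with exactly 24
    embeddings up to rigid motions, and scaling the copies so that glued edges
    have equal lengths makes the choices in different copies independent.  So a
    caterpillar of [k] copies gets exactly [24 ^ k] embeddings, and as
    [n / 4 = k + 1 / 2] this is [24 `^ (n / 4)] divided by [sqrt 24].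

    The single copy.  Identify the plane with the complex numbers and take the
    base triangle [a = -2], [b = 2], [c = i] and the platform
    [a' = -1], [b' = 1], [c' = (3 / 2) i], both symmetric about the imaginary
    axis; let the three legs have length 2.  After a rigid motion and possibly
    a reflection the base is in its standard position, and the platform, or its
    mirror image, has been turned by a unit complex number [u] and shifted by
    [t].  Put [v = u - 2].  The legs [aa'] and [bb'] say [|t - v| = 2] and
    [|t + v| = 2], that is, [t] is orthogonal to [v] and
    [|t|^2 + |v|^2 = 4].  So [t = lam i v] for a real [lam], and with [u = c + i s]
    the legs become
      [(1 + lam^2) (5 - 4 c) = 4]   and
      [|(lam + mu) u - (2 lam + 1)| = 2],   where [mu] is [3 / 2] or [- 3 / 2]
    according to whether the platform is flipped.  Eliminating [c] leaves a
    cubic in [lam].  The dimensions are such that for both signs of [mu] this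
    cubic has three rational roots, all of them with [|c| < 1].  Hence there are
    2 (mirror image) * 2 (flip) * 3 (root) * 2 (sign of [s]) = 24 embeddings;
    see [placement_edist], [placement_eqs_root], [prism_complete] and
    [prism_uniq].

    The gluing.  A direct similarity of the plane exists and is unique once the
    images of two distinct points are prescribed, so [24 ^ k] lists of choices
    can be realized by moving each copy onto the previous one
    ([common_ratios]).  Up to rigid motions an embedding is determined by its list
    of choices and determines it ([realizes_congruent], [congruent_same_poses]). *)

Set Implicit Arguments.
Unset Strict Implicit.
Unset Printing Implicit Defensive.

Import Order.TTheory GRing.Theory Num.Theory.
Local Open Scope ring_scope.

(** * Direct similarities of the plane *)

Section Plane.
Variable R : realType.
Notation plane := 'rV[R]_2.
Implicit Types (x y : plane) (f g : plane -> plane).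

Definition pt (a b : R) : plane := \row_j (if j == 0 then a else b).

Lemma pt_fst a b : pt a b 0 0 = a. Proof. by rewrite mxE. Qed.
Lemma pt_snd a b : pt a b 0 1 = b. Proof. by rewrite mxE. Qed.

Lemma planeP x y : x 0 0 = y 0 0 -> x 0 1 = y 0 1 -> x = y.
Proof.
move=> h0 h1; apply/rowP => -[[|[|//]] i_lt2].
- by rewrite (_ : Ordinal i_lt2 = 0) //; apply: val_inj.
- by rewrite (_ : Ordinal i_lt2 = 1) //; apply: val_inj.
Qed.

Lemma edist_ge0 x y : 0 <= edist x y.
Proof. exact: sqrtr_ge0. Qed.

Lemma edist_sqr x y :
  edist x y ^+ 2 = (x 0 0 - y 0 0) ^+ 2 + (x 0 1 - y 0 1) ^+ 2.
Proof.
rewrite /edist sqr_sqrtr; last by apply: sumr_ge0 => i _; exact: sqr_ge0.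
rewrite big_ord_recl big_ord1; congr (_ + (x 0 _ - y 0 _) ^+ 2);
by apply: val_inj.
Qed.

Lemma edistC x y : edist x y = edist y x.
Proof.
by apply/eqP; rewrite -(@eqrXn2 _ 2) ?edist_ge0 // !edist_sqr; apply/eqP; ring.
Qed.

Lemma edist_eqP x y (d : R) : 0 <= d ->
  (edist x y = d <-> (x 0 0 - y 0 0) ^+ 2 + (x 0 1 - y 0 1) ^+ 2 = d ^+ 2).
Proof.
move=> d0; rewrite -edist_sqr; split=> [->//|/eqP].
by rewrite eqrXn2 ?edist_ge0 // => /eqP.
Qed.

Lemma edist_gt0 x y : (0 < edist x y) = (x != y).
Proof.
rewrite lt0r edist_ge0 andbT; congr negb; apply/idP/idP => [|/eqP->].
  rewrite -sqrf_eq0 edist_sqr paddr_eq0 ?sqr_ge0 // !sqrf_eq0 !subr_eq0.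
  by case/andP=> /eqP h0 /eqP h1; apply/eqP/planeP.
by rewrite -sqrf_eq0 edist_sqr !subrr expr0n addr0.
Qed.

(** Orientation-preserving similarities, that is, the maps [z |-> (a + i b) z + c + i d]
    in complex notation.  For [k = 1] they are the rigid motions. *)
Definition similarity (k : R) (f : plane -> plane) : Prop :=
  exists a b c d, a ^+ 2 + b ^+ 2 = k ^+ 2 /\
    forall x, f x = pt (a * x 0 0 - b * x 0 1 + c) (b * x 0 0 + a * x 0 1 + d).

Lemma similarity_edist k f x y : 0 <= k -> similarity k f ->
  edist (f x) (f y) = k * edist x y.
Proof.
move=> k0 [a [b [c [d [abk fE]]]]]; apply/edist_eqP.
  by rewrite mulr_ge0 // edist_ge0.
by rewrite exprMn edist_sqr -abk !fE !pt_fst !pt_snd; ring.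
Qed.

Lemma similarity_id : similarity 1 id.
Proof.
exists 1, 0, 0, 0; split; first by ring.
by move=> x; apply: planeP; rewrite ?pt_fst ?pt_snd; ring.
Qed.

Lemma similarity_comp k k' f g :
  similarity k f -> similarity k' g -> similarity (k * k') (f \o g).
Proof.
move=> [a [b [c [d [abk fE]]]]] [a' [b' [c' [d' [abk' gE]]]]].
exists (a * a' - b * b'), (a * b' + b * a'),
  (a * c' - b * d' + c), (b * c' + a * d' + d); split.
  by rewrite exprMn -abk -abk'; ring.
by move=> x; rewrite /= fE gE; apply: planeP; rewrite ?pt_fst ?pt_snd; ring.
Qed.

Lemma similarity_inv k f : 0 < k -> similarity k f ->
  exists2 g, similarity k^-1 g & cancel f g /\ cancel g f.
Proof.
move=> k0 [a [b [c [d [abk fE]]]]].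
have kn0 : k != 0 by rewrite gt_eqF.
have k2 : k ^+ 2 != 0 by rewrite expf_neq0.
have abn : a ^+ 2 + b ^+ 2 != 0 by rewrite abk.
exists (fun x => pt ((a * (x 0 0 - c) + b * (x 0 1 - d)) / k ^+ 2)
                    ((a * (x 0 1 - d) - b * (x 0 0 - c)) / k ^+ 2)).
  exists (a / k ^+ 2), (- b / k ^+ 2), ((- a * c - b * d) / k ^+ 2),
    ((b * c - a * d) / k ^+ 2); split.
    transitivity ((a ^+ 2 + b ^+ 2) / (k ^+ 2) ^+ 2); first by field.
    by rewrite abk; field.
  by move=> x; apply: planeP; rewrite ?pt_fst ?pt_snd; field.
split=> x; rewrite fE; apply: planeP; rewrite ?pt_fst ?pt_snd -abk; field => //.
Qed.

(** The map is [z |-> x' + w (z - x)], where [w] is the complex quotient of [y' - x']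
    by [y - x]. *)
Lemma similarity_transport x y x' y' : x != y -> x' != y' ->
  exists2 f, similarity (edist x' y' / edist x y) f & f x = x' /\ f y = y'.
Proof.
move=> xy xy'.
have e0 : edist x y ^+ 2 != 0 by rewrite expf_neq0 // gt_eqF // edist_gt0.
pose u := y 0 0 - x 0 0; pose v := y 0 1 - x 0 1.
pose u' := y' 0 0 - x' 0 0; pose v' := y' 0 1 - x' 0 1.
have e : edist x y ^+ 2 = u ^+ 2 + v ^+ 2 by rewrite edist_sqr /u /v; ring.
have e' : edist x' y' ^+ 2 = u' ^+ 2 + v' ^+ 2 by rewrite edist_sqr /u' /v'; ring.
rewrite e in e0.
pose a := (u' * u + v' * v) / (u ^+ 2 + v ^+ 2).
pose b := (v' * u - u' * v) / (u ^+ 2 + v ^+ 2).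
exists (fun z => pt (a * z 0 0 - b * z 0 1 + (x' 0 0 - a * x 0 0 + b * x 0 1))
                    (b * z 0 0 + a * z 0 1 + (x' 0 1 - b * x 0 0 - a * x 0 1))).
  exists a, b, (x' 0 0 - a * x 0 0 + b * x 0 1), (x' 0 1 - b * x 0 0 - a * x 0 1).
  by split=> //; rewrite [RHS]exprMn [in RHS]exprVn e e' /a /b; field.
have yE : y 0 0 = x 0 0 + u /\ y 0 1 = x 0 1 + v by rewrite /u /v; split; ring.
have yE' : y' 0 0 = x' 0 0 + u' /\ y' 0 1 = x' 0 1 + v'
  by rewrite /u' /v'; split; ring.
split; apply: planeP; rewrite ?pt_fst ?pt_snd.
- by ring.
- by ring.
- by rewrite yE.1 yE.2 yE'.1 /a /b; field.
- by rewrite yE.1 yE.2 yE'.2 /a /b; field.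
Qed.

(** The difference of two such maps is [z |-> A z + B] for complex [A] and [B]; if it
    vanishes at two distinct points then [A = 0] and [B = 0]. *)
Lemma similarity_uniq k k' f g x y : similarity k f -> similarity k' g ->
  x != y -> f x = g x -> f y = g y -> f =1 g.
Proof.
move=> [a [b [c [d [_ fE]]]]] [a' [b' [c' [d' [_ gE]]]]] xy.
rewrite !fE !gE => /rowP fgx /rowP fgy z; rewrite fE gE.
move: (fgx 0) (fgx 1) (fgy 0) (fgy 1); rewrite !pt_fst !pt_snd => x0 x1 y0 y1.
have e0 : edist x y ^+ 2 != 0 by rewrite expf_neq0 // gt_eqF // edist_gt0.
(* Real and imaginary part of [A (x - y) = 0], multiplied by the conjugate of
   [x - y]. *)
have hA : (a - a') * edist x y ^+ 2 = 0.
  rewrite edist_sqr.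
  transitivity ((x 0 0 - y 0 0) *
    ((a * x 0 0 - b * x 0 1 + c) - (a' * x 0 0 - b' * x 0 1 + c')
     - ((a * y 0 0 - b * y 0 1 + c) - (a' * y 0 0 - b' * y 0 1 + c'))) +
    (x 0 1 - y 0 1) * ((b * x 0 0 + a * x 0 1 + d) - (b' * x 0 0 + a' * x 0 1 + d')
     - ((b * y 0 0 + a * y 0 1 + d) - (b' * y 0 0 + a' * y 0 1 + d')))); first by ring.
  by rewrite x0 x1 y0 y1; ring.
have hB : (b - b') * edist x y ^+ 2 = 0.
  rewrite edist_sqr.
  transitivity ((x 0 0 - y 0 0) *
    ((b * x 0 0 + a * x 0 1 + d) - (b' * x 0 0 + a' * x 0 1 + d')
     - ((b * y 0 0 + a * y 0 1 + d) - (b' * y 0 0 + a' * y 0 1 + d'))) -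
    (x 0 1 - y 0 1) * ((a * x 0 0 - b * x 0 1 + c) - (a' * x 0 0 - b' * x 0 1 + c')
     - ((a * y 0 0 - b * y 0 1 + c) - (a' * y 0 0 - b' * y 0 1 + c')))); first by ring.
  by rewrite x0 x1 y0 y1; ring.
have aa : a = a'.
  by apply/eqP; rewrite -subr_eq0 -[_ == _]orbF -(negPf e0) -mulf_eq0 hA.
have bb : b = b'.
  by apply/eqP; rewrite -subr_eq0 -[_ == _]orbF -(negPf e0) -mulf_eq0 hB.
by subst a' b'; congr pt; congr (_ + _); [move: x0 | move: x1]; apply: addrI.
Qed.

Lemma det_mx22 (A : 'M[R]_2) : \det A = A 0 0 * A 1 1 - A 0 1 * A 1 0.
Proof.
rewrite (expand_det_row A 0) big_ord_recl big_ord1 /cofactor !det_mx11 !mxE /=.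
have l01 : lift 0 0 = 1 :> 'I_2 by apply: val_inj.
have l10 : lift (lift 0 0) 0 = 0 :> 'I_2 by apply: val_inj.
rewrite l10 l01 expr0 expr1; ring.
Qed.

(** Isometry makes the rows of the matrix orthonormal, and with a positive
    determinant they are [(a, b)] and [(-b, a)]. *)
Lemma rigid_motionP f : rigid_motion f <-> similarity 1 f.
Proof.
split=> [[iso [A [t [fE detA]]]]|simf].
  have fE0 x : f x 0 0 = x 0 0 * A 0 0 + x 0 1 * A 1 0 + t 0 0.
    rewrite fE !mxE big_ord_recl big_ord1.
    by rewrite (_ : lift ord0 ord0 = 1) //; apply: val_inj.
  have fE1 x : f x 0 1 = x 0 0 * A 0 1 + x 0 1 * A 1 1 + t 0 1.
    rewrite fE !mxE big_ord_recl big_ord1.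
    by rewrite (_ : lift ord0 ord0 = 1) //; apply: val_inj.
  have sq x y : edist (f x) (f y) ^+ 2 = edist x y ^+ 2 by rewrite iso.
  move: (sq (pt 0 0) (pt 1 0)) (sq (pt 0 0) (pt 0 1)) (sq (pt 1 0) (pt 0 1)).
  rewrite !edist_sqr !fE0 !fE1 !pt_fst !pt_snd => s1 s2 s3.
  rewrite det_mx22 in detA.
  have s1' : A 0 0 ^+ 2 + A 0 1 ^+ 2 = 1 by lra.
  have s2' : A 1 0 ^+ 2 + A 1 1 ^+ 2 = 1 by lra.
  have s3' : A 0 0 * A 1 0 + A 0 1 * A 1 1 = 0 by lra.
  have det1 : A 0 0 * A 1 1 - A 0 1 * A 1 0 = 1.
    apply/eqP; rewrite -(@eqrXn2 _ 2) ?ler01 ?ltW //; apply/eqP.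
    transitivity ((A 0 0 ^+ 2 + A 0 1 ^+ 2) * (A 1 0 ^+ 2 + A 1 1 ^+ 2) -
       (A 0 0 * A 1 0 + A 0 1 * A 1 1) ^+ 2); first by ring.
    by rewrite s1' s2' s3'; ring.
  (* This sum of squares is [2 - 2 \det A]. *)
  have : (A 1 1 - A 0 0) ^+ 2 + (A 1 0 + A 0 1) ^+ 2 = 0 by lra.
  move/eqP; rewrite paddr_eq0 ?sqr_ge0 // !sqrf_eq0 subr_eq0 addr_eq0.
  case/andP=> /eqP A11 /eqP A10.
  exists (A 0 0), (A 0 1), (t 0 0), (t 0 1); split; first by rewrite expr1n.
  by move=> x; apply: planeP; rewrite ?pt_fst ?pt_snd ?fE0 ?fE1 ?A10 ?A11; ring.
split=> [x y|]; first by rewrite (similarity_edist _ _ ler01 simf) mul1r.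
case: simf => a [b [c [d [ab fE]]]].
exists (\matrix_(i, j) if i == 0 then pt a b 0 j else pt (- b) a 0 j), (pt c d).
split=> [x|].
  rewrite fE; apply: planeP; rewrite !mxE big_ord_recl big_ord1 !mxE /=;
  rewrite (_ : lift ord0 ord0 = 1) //; try exact: val_inj; by ring.
rewrite det_mx22 !mxE /=; move: ab; rewrite expr1n => ab.
suff -> : a * a - b * - b = 1 by exact: ltr01.
by rewrite -ab; ring.
Qed.
End Plane.

(** * A Desargues framework with 24 embeddings *)

Section Prism.
Variable R : realType.
Notation plane := 'rV[R]_2.

Definition sgn (b : bool) : R := (-1) ^+ b.

Lemma sgn_sqr b : sgn b ^+ 2 = 1.
Proof. by rewrite /sgn -exprM mulnC exprM sqrrN expr1n expr1n. Qed.

Lemma sgnK b x : sgn b * (sgn b * x) = x.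
Proof. by rewrite mulrA -expr2 sgn_sqr mul1r. Qed.

Lemma sqr_eq_sgn (x y : R) : x ^+ 2 = y ^+ 2 -> exists b, x = sgn b * y.
Proof.
move/eqP; rewrite eqf_sqr => /orP[] /eqP->; [exists false | exists true];
by rewrite /sgn ?expr0 ?expr1 ?mul1r ?mulN1r.
Qed.

Lemma sgn_inj : injective sgn.
Proof. by move=> [] [] //; rewrite /sgn expr0 expr1 => h; exfalso; lra. Qed.

(** Squared lengths.  The base has sides [4, sqrt 5, sqrt 5], the platform
    [2, sqrt 13 / 2, sqrt 13 / 2], and the legs have length 2. *)
Definition prism_sqlen (u v : desargues_vertex) : R :=
  if u.1 != v.1 then 4 else
  if (u.2 == 2) || (v.2 == 2) then (if u.1 then 13 / 4 else 5)
  else (if u.1 then 4 else 16).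

Definition prism_len u v := Num.sqrt (prism_sqlen u v).

Lemma prism_sqlen_gt0 u v : 0 < prism_sqlen u v.
Proof. by rewrite /prism_sqlen; do ?case: ifP => _; lra. Qed.

Lemma prism_len_gt0 u v : 0 < prism_len u v.
Proof. by rewrite sqrtr_gt0 prism_sqlen_gt0. Qed.

Lemma prism_len_sqr u v : prism_len u v ^+ 2 = prism_sqlen u v.
Proof. by rewrite sqr_sqrtr // ltW // prism_sqlen_gt0. Qed.

(** The base in its standard position, and the platform turned by [u = c + i s],
    flipped if [flip], and shifted by [t = lam i (u - 2)]; so [a'] and [b'] are [t - u]
    and [t + u], and [c'] is [t + mu i u] with [mu = 3 / 2] or [- 3 / 2].  All this is
    reflected in the real axis if [mirror]. *)
Definition symmetric_placement (mirror flip : bool) (lam c s : R)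
    (v : desargues_vertex) : plane :=
  let q := match v.1, val v.2 with
    | false, 0 => (- 2, 0)
    | false, 1 => (2, 0)
    | false, _ => (0, 1)
    | true, 0 => (- lam * s - c, lam * (c - 2) - s)
    | true, 1 => (- lam * s + c, lam * (c - 2) + s)
    | true, _ => (- lam * s - sgn flip * (3 / 2) * s,
                  lam * (c - 2) + sgn flip * (3 / 2) * c)
    end in
  pt q.1 (sgn mirror * q.2).

(** The conditions [|aa'| = |bb'| = 2] and [|cc'| = 2], freed of [s] by
    [c^2 + s^2 = 1]. *)
Definition placement_eqs (flip : bool) (lam c : R) : Prop :=
  let mu := lam + sgn flip * (3 / 2) in
  (1 + lam ^+ 2) * (5 - 4 * c) = 4 /\
  mu ^+ 2 + (2 * lam + 1) ^+ 2 - 2 * mu * (2 * lam + 1) * c = 4.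

Lemma placement_edist mirror flip lam c s u v :
  c ^+ 2 + s ^+ 2 = 1 -> placement_eqs flip lam c -> desargues u v ->
  edist (symmetric_placement mirror flip lam c s u)
        (symmetric_placement mirror flip lam c s v) = prism_len u v.
Proof.
move=> cs [e1 e3] uv; apply/edist_eqP; first by rewrite ltW ?prism_len_gt0.
have m2 := sgn_sqr mirror; have f2 := sgn_sqr flip.
rewrite prism_len_sqr; move: e3 f2 m2 uv; rewrite /symmetric_placement.
set f := sgn flip; set m := sgn mirror => e3 f2 m2.
have s2 : s ^+ 2 = 1 - c ^+ 2 by lra.
(* Multiples of [s2] and [f2] that make the nine identities linear in monomials. *)
have s2l : lam ^+ 2 * s ^+ 2 = lam ^+ 2 * (1 - c ^+ 2) by rewrite s2.
have s2f : f * lam * s ^+ 2 = f * lam * (1 - c ^+ 2) by rewrite s2.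
have f2s : f ^+ 2 * s ^+ 2 = 1 - c ^+ 2 by rewrite f2 s2 mul1r.
have f2c : f ^+ 2 * c ^+ 2 = c ^+ 2 by rewrite f2 mul1r.
have mirrorE (x x' y y' : R) : (x - x') ^+ 2 + (m * y - m * y') ^+ 2 =
  (x - x') ^+ 2 + (y - y') ^+ 2 by rewrite -mulrBr exprMn m2 mul1r.
case: u v => [[] [[|[|[|//]]] ?]] [[] [[|[|[|//]]] ?]];
  rewrite /desargues /prism_sqlen -!(inj_eq val_inj) /= => // _;
  rewrite !pt_fst !pt_snd mirrorE; try lra.
Qed.

(** A vector orthogonal to [v] is a real multiple of [i v]. *)
Lemma perp_factor (x0 x1 v0 v1 : R) : v0 ^+ 2 + v1 ^+ 2 != 0 ->
  x0 * v0 + x1 * v1 = 0 -> exists z, x0 = - z * v1 /\ x1 = z * v0.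
Proof.
move=> v_neq0 xv; exists ((x1 * v0 - x0 * v1) / (v0 ^+ 2 + v1 ^+ 2)).
have h : x0 * v0 = - (x1 * v1) by lra.
split; apply: (mulIf v_neq0); rewrite ?mulrN ?mulNr.
  transitivity (v0 * (x0 * v0) + x0 * v1 ^+ 2); first by ring.
  by rewrite h; field.
transitivity (x1 * v0 ^+ 2 + v1 * (x1 * v1)); first by ring.
by rewrite (_ : x1 * v1 = - (x0 * v0)); [field | lra].
Qed.

(** If the base and the platform are isosceles with half-widths [w], [w'] and
    heights [w g], [w' g'], and the legs have lengths [r], [r], [r'], then [lam] solves
      [(1 + lam^2) ((w^2 - w'^2) (g - g') lam + (g - g') (w^2 g - w'^2 g') - r'^2)
        + r^2 (lam + g) (lam + g') = 0],
    and flipping the platform changes the sign of [g'].  The dimensions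
    [w = 2], [w' = 1], [g = 1 / 2], [g' = 3 / 2], [r = r' = 2] are chosen so that
    both cubics split over the rationals with [|c| < 1] at each of the six roots. *)
Definition root_lam (flip : bool) (k : 'I_3) : R :=
  nth 0 (if flip then [:: - (2 / 3); - (1 / 2); 0]
         else [:: - (3 / 2); 1 / 3; 1]) k.

Definition root_cos (flip : bool) (k : 'I_3) : R :=
  nth 0 (if flip then [:: 29 / 52; 9 / 20; 1 / 4]
         else [:: 49 / 52; 7 / 20; 3 / 4]) k.

Lemma root_placement_eqs flip k : placement_eqs flip (root_lam flip k) (root_cos flip k).
Proof.
by case: flip k => [] [[|[|[|//]]] ?];
  rewrite /placement_eqs /root_lam /root_cos /sgn /= ?expr0 ?expr1; split; field.
Qed.

(** The first equation gives [c] as a function of [lam]; substituting it in the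
    second and clearing denominators, the terms of degree 4 cancel and a cubic
    with the three listed roots remains. *)
Lemma placement_eqs_root flip lam c : placement_eqs flip lam c ->
  exists k, lam = root_lam flip k /\ c = root_cos flip k.
Proof.
move=> [e1 e3].
have cubic : 2 * (1 + lam ^+ 2) *
    ((lam + sgn flip * (3 / 2)) ^+ 2 + (2 * lam + 1) ^+ 2 - 4) =
    (lam + sgn flip * (3 / 2)) * (2 * lam + 1) * (5 * (1 + lam ^+ 2) - 4).
  have -> : (lam + sgn flip * (3 / 2)) ^+ 2 + (2 * lam + 1) ^+ 2 - 4 =
    2 * (lam + sgn flip * (3 / 2)) * (2 * lam + 1) * c by rewrite -e3; ring.
  have -> : 5 * (1 + lam ^+ 2) - 4 = 4 * c * (1 + lam ^+ 2) by rewrite -[in LHS]e1; ring.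
  by ring.
have cE k : lam = root_lam flip k -> c = root_cos flip k.
  move=> lamE; have [e1' _] := root_placement_eqs flip k.
  rewrite -lamE in e1'; have n0 : 1 + lam ^+ 2 != 0.
    by rewrite gt_eqF // ltr_pwDl // sqr_ge0.
  by have /(mulfI n0) := etrans e1' (esym e1); lra.
suff [k lamE] : exists k, lam = root_lam flip k by exists k; split=> //; exact: cE.
have factored : \prod_k (lam - root_lam flip k) = 0.
  rewrite !big_ord_recr big_ord0 /root_lam /= mul1r.
  case: flip cubic {e3 cE}; rewrite /sgn /= ?expr0 ?expr1 => cubic; [lra|lra].
move/eqP/prodf_eq0: factored => [k _]; rewrite subr_eq0 => /eqP lamE.
by exists k.
Qed.

(** The six cosines differ, so the turning angle alone reveals both the flip and
    the root. *)
Lemma root_cos_inj flip flip' k k' :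
  root_cos flip k = root_cos flip' k' -> flip = flip' /\ k = k'.
Proof.
case: flip k => [] [[|[|[|//]]] ?]; case: flip' k' => [] [[|[|[|//]]] ?];
rewrite /root_cos /= => h; first [by split=> //; apply: val_inj | exfalso; lra].
Qed.

Definition root_sin flip k : R := Num.sqrt (1 - root_cos flip k ^+ 2).

Lemma root_sin_gt0 flip k : 0 < root_sin flip k.
Proof.
by rewrite sqrtr_gt0; case: flip k => [] [[|[|[|//]]] ?]; rewrite /root_cos /=; lra.
Qed.

Lemma root_cos_sin b flip k : root_cos flip k ^+ 2 + (sgn b * root_sin flip k) ^+ 2 = 1.
Proof.
rewrite exprMn sgn_sqr mul1r sqr_sqrtr; first by ring.
by apply: ltW; rewrite -sqrtr_gt0 root_sin_gt0.
Qed.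

(** Mirror image, flip of the platform, root of the cubic, sign of [s]. *)
Definition pose_index : finType := (bool * bool * 'I_3 * bool)%type.

Lemma card_pose_index : #|pose_index| = 24%N.
Proof. by rewrite !card_prod card_bool card_ord. Qed.

Definition prism (j : pose_index) : desargues_vertex -> plane :=
  let: (mirror, flip, k, side) := j in
  symmetric_placement mirror flip (root_lam flip k) (root_cos flip k)
    (sgn side * root_sin flip k).

Lemma prism_edist j u v : desargues u v -> edist (prism j u) (prism j v) = prism_len u v.
Proof.
case: j => [[[m f] k] b] uv; apply: placement_edist => //.
- exact: root_cos_sin.
- exact: root_placement_eqs.
Qed.

Definition va : desargues_vertex := (false, 0).
Definition vb : desargues_vertex := (false, 1).

Lemma vertex_ind (P : desargues_vertex -> Prop) :
  P va -> P vb -> P (false, 2) -> P (true, 0) -> P (true, 1) -> P (true, 2) ->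
  forall v, P v.
Proof.
move=> Pa Pb Pc Pa' Pb' Pc' [[] [[|[|[|//]]] i3]];
  by [ rewrite (_ : Ordinal i3 = 0) //; apply: val_inj
     | rewrite (_ : Ordinal i3 = 1) //; apply: val_inj
     | rewrite (_ : Ordinal i3 = 2) //; apply: val_inj].
Qed.

Lemma prism_a j : prism j va = pt (- 2) 0.
Proof.
by case: j => [[[m f] k] b]; rewrite /prism /symmetric_placement /= mulr0.
Qed.

Lemma prism_b j : prism j vb = pt 2 0.
Proof.
by case: j => [[[m f] k] b]; rewrite /prism /symmetric_placement /= mulr0.
Qed.

Lemma prism_inj j j' : prism j =1 prism j' -> j = j'.
Proof.
case: j j' => [[[m f] k] b] [[[m' f'] k'] b'] jj'.
have snd u := congr1 (fun x : plane => x 0 1) (jj' u).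
have fst u := congr1 (fun x : plane => x 0 0) (jj' u).
have mm' : m = m'.
  by apply: sgn_inj; move: (snd (false, 2));
     rewrite /= /symmetric_placement /= !pt_snd !mulr1.
have cc' : root_cos f k = root_cos f' k'.
  move: (fst (true, 0)) (fst (true, 1)).
  by rewrite /= /symmetric_placement /= !pt_fst => h h'; lra.
have [ff' kk'] := root_cos_inj cc'; subst m' f' k'.
suff -> : b = b' by [].
move: (snd (true, 0)) (snd (true, 1)).
rewrite /= /symmetric_placement /= !pt_snd.
move=> /(congr1 ( *%R (sgn m))) + /(congr1 ( *%R (sgn m))).
rewrite !sgnK => h h'; apply: sgn_inj.
by apply: (mulIf (lt0r_neq0 (root_sin_gt0 f k))); lra.
Qed.

(** Pinning [a] and [b] uses up the rigid motions, and what remains are the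
    equations solved above. *)
Lemma prism_complete_pinned (p : desargues_vertex -> plane) :
  (forall u v, desargues u v -> edist (p u) (p v) = prism_len u v) ->
  p va = pt (- 2) 0 -> p vb = pt 2 0 -> exists j, p =1 prism j.
Proof.
move=> plen pa pb.
have sq u v : desargues u v ->
    (p u 0 0 - p v 0 0) ^+ 2 + (p u 0 1 - p v 0 1) ^+ 2 = prism_sqlen u v.
  by move=> uv; rewrite -edist_sqr plen // prism_len_sqr.
pose vc : desargues_vertex := (false, 2).
pose va' : desargues_vertex := (true, 0).
pose vb' : desargues_vertex := (true, 1).
pose vc' : desargues_vertex := (true, 2).
move: (sq va vc isT) (sq vb vc isT) (sq va va' isT) (sq vb vb' isT)
      (sq vc vc' isT) (sq va' vb' isT) (sq va' vc' isT) (sq vb' vc' isT).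
rewrite /prism_sqlen /= pa pb !pt_fst !pt_snd => ac bc aa bb cc ab' ac' bc'.
have c0 : p vc 0 0 = 0 by lra.
have [m c1] : exists m, p vc 0 1 = sgn m * 1.
  by apply: sqr_eq_sgn; rewrite c0 in ac; lra.
have m2 := sgn_sqr m.
(* Reflecting if necessary, assume that [c] is [i]; the coordinates after this
   reflection are [x] and [y]. *)
have [x [y [xE yE]]] : exists x y : desargues_vertex -> R,
    (forall u, p u 0 0 = x u) /\ (forall u, p u 0 1 = sgn m * y u).
  exists (fun u => p u 0 0), (fun u => sgn m * p u 0 1).
  by split=> u //; rewrite sgnK.
have mirrorE (x0 x1 y0 y1 : R) : (x0 - x1) ^+ 2 + (sgn m * y0 - sgn m * y1) ^+ 2 =
  (x0 - x1) ^+ 2 + (y0 - y1) ^+ 2 by rewrite -mulrBr exprMn m2 mul1r.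
rewrite -(mulr0 (sgn m)) in aa bb.
rewrite ?c0 ?c1 !xE !yE !mirrorE in aa bb cc ab' ac' bc'.
(* The unit vector [u = c + i s] and the shift [t], read off from [a'] and [b']. *)
pose c := (x vb' - x va') / 2; pose s := (y vb' - y va') / 2.
pose t0 := (x va' + x vb') / 2; pose t1 := (y va' + y vb') / 2.
have xa : x va' = t0 - c by rewrite /t0 /c; field.
have xb : x vb' = t0 + c by rewrite /t0 /c; field.
have ya : y va' = t1 - s by rewrite /t1 /s; field.
have yb : y vb' = t1 + s by rewrite /t1 /s; field.
rewrite xa xb ya yb in aa bb ab' ac' bc'.
have cs : c ^+ 2 + s ^+ 2 = 1 by lra.
have v2 : (c - 2) ^+ 2 + s ^+ 2 = 5 - 4 * c by lra.
have c_le1 : c <= 1 by nra.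
(* The equations of [aa'] and [bb'] differ by a multiple of the scalar product of
   [t] and [u - 2]. *)
have [lam [t0E t1E]] : exists lam, t0 = - lam * s /\ t1 = lam * (c - 2).
  by apply: perp_factor; [rewrite v2 gt_eqF //; lra | lra].
have e1 : (1 + lam ^+ 2) * (5 - 4 * c) = 4.
  by rewrite -v2; move: aa; rewrite t0E t1E => aa; lra.
(* [c'] is equidistant from [a'] and [b'], so [c' - t] is orthogonal to [u]. *)
have [mu [d0E d1E]] : exists mu, x vc' - t0 = - mu * s /\ y vc' - t1 = mu * c.
  by apply: perp_factor; [rewrite cs oner_neq0 | lra].
have mu2 : mu ^+ 2 = (3 / 2) ^+ 2.
  transitivity (mu ^+ 2 * (c ^+ 2 + s ^+ 2)); first by rewrite cs mulr1.
  transitivity ((x vc' - t0) ^+ 2 + (y vc' - t1) ^+ 2); last by lra.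
  by rewrite d0E d1E; ring.
have [f muE] := sqr_eq_sgn mu2.
have xd : x vc' = t0 - mu * s by lra.
have yd : y vc' = t1 + mu * c by lra.
have e3 : (lam + sgn f * (3 / 2)) ^+ 2 + (2 * lam + 1) ^+ 2
    - 2 * (lam + sgn f * (3 / 2)) * (2 * lam + 1) * c = 4.
  rewrite -muE -[RHS]cc xd yd t0E t1E.
  transitivity ((lam + mu) ^+ 2 * (c ^+ 2 + s ^+ 2) + (2 * lam + 1) ^+ 2
    - 2 * (lam + mu) * (2 * lam + 1) * c); first by rewrite cs mulr1.
  by ring.
have [k [lamE cE]] := placement_eqs_root (conj e1 e3).
have [b sE] : exists b, s = sgn b * root_sin f k.
  apply: sqr_eq_sgn; have := root_cos_sin false f k.
  by rewrite exprMn sgn_sqr mul1r -cE -cs => /addrI.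
exists (m, f, k, b); rewrite /prism -lamE -cE -sE.
apply: vertex_ind; apply: planeP; rewrite /symmetric_placement /= ?pt_fst ?pt_snd
  ?pa ?pb ?pt_fst ?pt_snd ?xE ?yE ?mulr0 //.
- by rewrite -xE.
- by rewrite -yE.
- by rewrite [LHS]xa t0E.
- by rewrite [y _]ya t1E.
- by rewrite [LHS]xb t0E.
- by rewrite [y _]yb t1E.
- by rewrite [LHS]xd t0E muE.
- by rewrite [y _]yd t1E muE.
Qed.

Lemma va_neq_vb j : prism j va != prism j vb.
Proof. by rewrite -edist_gt0 prism_edist // prism_len_gt0. Qed.

Lemma prism_complete mu (p : desargues_vertex -> plane) : 0 < mu ->
  (forall u v, desargues u v -> edist (p u) (p v) = mu * prism_len u v) ->
  exists j, exists2 f, similarity mu f & p =1 f \o prism j.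
Proof.
move=> mu0 plen; pose j0 : pose_index := (false, false, 0, false).
have pab : p va != p vb by rewrite -edist_gt0 plen // mulr_gt0 ?prism_len_gt0.
have [f] := similarity_transport (va_neq_vb j0) pab.
rewrite plen // prism_edist // mulfK ?gt_eqF ?prism_len_gt0 // => simf [fa fb].
have [g simg [fK gK]] := similarity_inv mu0 simf.
have [|||j pj] := @prism_complete_pinned (g \o p).
- move=> u v uv; rewrite /= (similarity_edist _ _ _ simg) ?invr_ge0 ?ltW //.
  by rewrite plen // mulKf // gt_eqF.
- by rewrite /= -fa fK prism_a.
- by rewrite /= -fb fK prism_b.
by exists j, f => // u; rewrite /= -pj /= gK.
Qed.

(** All 24 embeddings agree at [a] and [b], so [f] and [g] do too and are equal. *)
Lemma prism_uniq k k' f g j j' : 0 < k -> similarity k f -> similarity k' g ->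
  f \o prism j =1 g \o prism j' -> j = j'.
Proof.
move=> k0 simf simg fg; have [h _ [fK _]] := similarity_inv k0 simf.
have fgE : f =1 g.
  apply: (similarity_uniq simf simg (va_neq_vb j)).
    by rewrite [LHS]fg /= !prism_a.
  by rewrite [LHS]fg /= !prism_b.
by apply: prism_inj => u; apply: (can_inj fK); rewrite [LHS]fg /= fgE.
Qed.
End Prism.

(** * The combinatorics of caterpillars *)

Lemma desargues_neq u v : desargues u v -> u != v.
Proof. by apply: contraTneq => ->; rewrite /desargues !eqxx. Qed.

Lemma desarguesC u v : desargues u v = desargues v u.
Proof. by rewrite /desargues ![v.1 == _]eq_sym ![v.2 == _]eq_sym. Qed.

Lemma quad_edgesP m E : E \in quad_edges m ->
  exists u v, desargues u v /\ E = [set u; v]%SET.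
Proof.
rewrite inE => /existsP[u /existsP[v /and4P[_ _ uv /eqP->]]].
by exists u, v.
Qed.

Section Caterpillar.
Variables (k n : nat) (e : rel 'I_n) (D : nat -> desargues_vertex -> 'I_n).
Variables (m : nat -> 'I_3) (S : nat -> {set 'I_n}).
Hypothesis cat : caterpillar_data k e D m S.

Lemma copy_inj i u v : (i < k)%N -> D i u = D i v -> u = v.
Proof. by move=> /(cat_inj cat); apply. Qed.

(** The two copies see the glued edge with independent labellings of its ends;
    renaming the ends in the later copy aligns them. *)
Lemma glue_edge i : (i.+1 < k)%N -> exists u v u' v',
  [/\ desargues u v, desargues u' v', D i u = D i.+1 u', D i v = D i.+1 v' &
      S i = [set D i u; D i v]%SET].
Proof.
move=> ik; have [E /quad_edgesP[u [v [uv ->]]] SE] := cat_glue_left cat ik.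
have [E' /quad_edgesP[u' [v' [uv' ->]]] SE'] := cat_glue_right cat ik.
rewrite imsetU1 imset_set1 in SE; rewrite imsetU1 imset_set1 in SE'.
have Duv : D i u != D i v.
  by apply: contra (desargues_neq uv) => /eqP/(copy_inj (ltnW ik))->.
have : D i v \in S i by rewrite SE !inE eqxx orbT.
have : D i u \in S i by rewrite SE !inE eqxx.
rewrite SE' !inE => /orP[] /eqP Du /orP[] /eqP Dv.
- by rewrite Du Dv eqxx in Duv.
- by exists u, v, u', v'; rewrite Du Dv.
- by exists u, v, v', u'; split; rewrite ?Du ?Dv // 1?desarguesC // finset.setUC.
- by rewrite Du Dv eqxx in Duv.
Qed.

Lemma shared_vertex i j u v : (j.+1 < k)%N -> (i <= j)%N -> D i u = D j.+1 v ->
  D j.+1 v \in S j.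
Proof.
move=> jk ij Duv; rewrite -(cat_meet cat jk) !inE imset_f // andbT -Duv.
by apply/bigcupP; exists (Ordinal (ij : (i < j.+1)%N)); rewrite // imset_f.
Qed.

Lemma glue_ends i : (i.+1 < k)%N -> exists u v u' v',
  [/\ desargues u v, desargues u' v', D i u = D i.+1 u', D i v = D i.+1 v' &
      forall w w', D i w = D i.+1 w' -> (w, w') = (u, u') \/ (w, w') = (v, v')].
Proof.
move=> ik; have [u [v [u' [v' [uv uv' Du Dv SE]]]]] := glue_edge ik.
exists u, v, u', v'; split=> // w w' Dw.
have := shared_vertex ik (leqnn i) Dw.
rewrite SE !inE Du Dv => /orP[] /eqP Dw'.
  by left; rewrite (copy_inj ik Dw'); congr pair; apply: (copy_inj (ltnW ik));
     rewrite Dw Dw' Du.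
by right; rewrite (copy_inj ik Dw'); congr pair; apply: (copy_inj (ltnW ik));
   rewrite Dw Dw' Dv.
Qed.

(** Consecutive copies suffice: a vertex common to two distant copies lies in all
    copies in between, because a new copy meets the union of the earlier ones
    only in vertices of its predecessor; see [matching_consistent]. *)
Definition matching X (q : nat -> desargues_vertex -> X) : Prop :=
  forall i, (i.+1 < k)%N -> forall w w', D i w = D i.+1 w' -> q i w = q i.+1 w'.

Lemma matching_consistent X (q : nat -> desargues_vertex -> X) : matching q ->
  forall i j u v, (i <= j)%N -> (j < k)%N -> D i u = D j v -> q i u = q j v.
Proof.
move=> mq i j u v ij; elim: j v ij => [|j IHj] v.
  by rewrite leqn0 => /eqP-> k0 /(copy_inj k0)->.
rewrite leq_eqVlt => /orP[/eqP-> jk /(copy_inj jk)->//|].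
rewrite ltnS => ij jk Duv; have := shared_vertex jk ij Duv.
have [w [w2 [w' [w2' [_ _ Dw Dw2 ->]]]]] := glue_edge jk.
have Dlift x : D j.+1 v = D j x -> q i u = q j.+1 v.
  move=> Dv; rewrite (IHj x) ?(mq j jk x v) //; first exact: ltnW.
  by rewrite Duv.
by rewrite !inE => /orP[] /eqP; apply: Dlift.
Qed.

Lemma glue_maps X (q : nat -> desargues_vertex -> X) : matching q ->
  exists p : 'I_n -> X, forall i u, (i < k)%N -> p (D i u) = q i u.
Proof.
move=> mq; have : forall x : 'I_n, exists y : X,
    forall i u, (i < k)%N -> D i u = x -> q i u = y.
  move=> x; have [j jk [v ->]] := cat_vertices cat x.
  exists (q j v) => i u ik Duv; case: (leqP i j) => [ij|/ltnW ji].
    exact: matching_consistent Duv.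
  exact/esym/(matching_consistent mq ji ik).
by move/choice=> [p pE]; exists p => i u ik; rewrite (pE (D i u) i u).
Qed.

Lemma card_copy i : (i < k)%N ->
  #|[set D i u | u in [set: desargues_vertex]%SET]%SET| = 6%N.
Proof.
by move=> /(cat_inj cat) injD; rewrite card_imset // cardsT card_prod card_bool card_ord.
Qed.

(** Each copy brings 6 vertices, of which the two on the glued edge are old. *)
Lemma card_first_copies i : (i < k)%N ->
  #|\bigcup_(j < i.+1) [set D j u | u in [set: desargues_vertex]%SET]%SET|
    = (4 * i + 6)%N.
Proof.
elim: i => [|i IHi] ik; first by rewrite big_ord_recr big_ord0 /= finset.set0U card_copy.
rewrite big_ord_recr /= cardsU (cat_meet cat ik) IHi ?card_copy //; last exact: ltnW.
have [u [v [_ [_ [uv _ _ _ ->]]]]] := glue_edge ik.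
have Duv : D i u != D i v.
  by apply: contra (desargues_neq uv) => /eqP/(copy_inj (ltnW ik))->.
by rewrite cards2 Duv; lia.
Qed.

Lemma caterpillar_order : (0 < k)%N -> n = (4 * k + 2)%N.
Proof.
move=> k0; have kE : k.-1.+1 = k by rewrite prednK.
rewrite -[LHS]card_ord -cardsT.
transitivity #|\bigcup_(j < k.-1.+1) [set D j u | u in [set: desargues_vertex]%SET]%SET|.
  congr #|pred_of_set _|; apply/setP => x; rewrite finset.in_setT; apply/esym/bigcupP.
  have [j jk [u ->]] := cat_vertices cat x.
  have jk' : (j < k.-1.+1)%N by rewrite kE.
  by exists (Ordinal jk'); rewrite // imset_f.
by rewrite card_first_copies; lia.
Qed.

End Caterpillar.

(** * Embeddings of a caterpillar *)

Section Gluing.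
Variable R : realType.
Notation plane := 'rV[R]_2.
Variables (k n : nat) (e : rel 'I_n) (D : nat -> desargues_vertex -> 'I_n).
Variables (m : nat -> 'I_3) (S : nat -> {set 'I_n}).
Hypothesis cat : caterpillar_data k e D m S.

(** The [i]-th copy has the pose number [s i], scaled by [mu i]. *)
Definition realizes (mu : nat -> R) (s : nat -> pose_index) (p : 'I_n -> plane) : Prop :=
  forall i, (i < k)%N ->
    exists2 f, similarity (mu i) f & forall u, p (D i u) = f (prism R (s i) u).

Lemma prism_neq j u v : desargues u v -> prism R j u != prism R j v.
Proof. by move=> uv; rewrite -edist_gt0 prism_edist // prism_len_gt0. Qed.

Lemma realizes_edist mu s p i u v : realizes mu s p -> 0 <= mu i -> (i < k)%N ->
  desargues u v -> edist (p (D i u)) (p (D i v)) = mu i * prism_len R u v.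
Proof.
move=> rp mu0 ik uv; have [f simf fE] := rp i ik.
by rewrite !fE (similarity_edist _ _ mu0 simf) prism_edist.
Qed.

(** Each copy is moved by the similarity that carries its side of the glued edge
    to the place where the previous copy has put that edge. *)
Lemma realizable s : exists mu p,
  [/\ mu 0 = 1, forall i, 0 < mu i & realizes mu s p].
Proof.
pose sim := {x : R * (plane -> plane) | 0 < x.1 /\ similarity x.1 x.2}.
have step (x : nat * sim) : exists y : sim, (x.1.+1 < k)%N ->
    forall w w', D x.1 w = D x.1.+1 w' ->
      (sval x.2).2 (prism R (s x.1) w) = (sval y).2 (prism R (s x.1.+1) w').
  case: x => i [[r f] [/= r0 simf]].
  case: (boolP (i.+1 < k)%N) => [ik|_]; last first.
    by exists (exist _ (1, id) (conj ltr01 (similarity_id R))).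
  have [u [v [u' [v' [uv uv' Du Dv ends]]]]] := glue_ends cat ik.
  have fuv : f (prism R (s i) u) != f (prism R (s i) v).
    by rewrite -edist_gt0 (similarity_edist _ _ (ltW r0) simf) mulr_gt0 ?edist_gt0
      ?prism_neq.
  have uv'n := prism_neq (s i.+1) uv'.
  have [g simg [gu gv]] := similarity_transport uv'n fuv.
  have r'0 : 0 < edist (f (prism R (s i) u)) (f (prism R (s i) v)) /
    edist (prism R (s i.+1) u') (prism R (s i.+1) v') by rewrite divr_gt0 ?edist_gt0.
  exists (exist _ (_, g) (conj r'0 simg)) => _ w w' /ends[] [-> ->] /=; by [].
have {step} [next nextP] := choice step.
pose sims := fix sims i : sim :=
  if i is i'.+1 then next (i', sims i')
  else exist _ (1, id) (conj ltr01 (similarity_id R)).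
have matched : matching k D (fun i u => (sval (sims i)).2 (prism R (s i) u)).
  by move=> i ik w w' Dw; exact: (nextP (i, sims i) ik).
have [p pE] := glue_maps cat matched.
exists (fun i => (sval (sims i)).1), p; split=> // [i|i ik].
  by have [] := svalP (sims i).
by exists (sval (sims i)).2 => [|u]; [have [] := svalP (sims i) | exact: pE].
Qed.

(** The ratio of consecutive scales is the quotient of the two lengths which the
    glued edge has in the unscaled copies, and these lengths are common to all 24
    poses. *)
Lemma ratio_unique mu mu' s s' p p' : mu 0 = mu' 0 ->
  (forall i, 0 < mu i) -> (forall i, 0 < mu' i) ->
  realizes mu s p -> realizes mu' s' p' -> forall i, (i < k)%N -> mu i = mu' i.
Proof.
move=> mu0 mup mup' rp rp'; elim=> [//|i IHi] ik.
have [u [v [u' [v' [uv uv' Du Dv _]]]]] := glue_ends cat ik.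
apply: (mulIf (lt0r_neq0 (prism_len_gt0 R u' v'))).
have := realizes_edist rp (ltW (mup i)) (ltnW ik) uv.
have := realizes_edist rp' (ltW (mup' i)) (ltnW ik) uv.
rewrite Du Dv (realizes_edist rp) ?(realizes_edist rp') ?(ltW (mup _)) ?(ltW (mup' _)) //.
by move=> -> ->; rewrite IHi // ltnW.
Qed.

Lemma common_ratios : exists mu : nat -> R, (forall i, 0 < mu i) /\
  forall s, exists p, realizes mu s p.
Proof.
have [mu [p [mu0 mup rp]]] := realizable (fun=> (false, false, 0, false)).
exists mu; split=> // s; have [mu' [p' [mu0' mup' rp']]] := realizable s.
exists p' => i ik; have [f simf fE] := rp' i ik.
by exists f; rewrite // (ratio_unique _ mup mup' rp rp') // mu0.
Qed.

Lemma congruent_same_poses mu s s' p p' : (forall i, 0 < mu i) ->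
  realizes mu s p -> realizes mu s' p' -> congruent p p' ->
  forall i, (i < k)%N -> s i = s' i.
Proof.
move=> mup rp rp' [h /rigid_motionP simh p'E] i ik.
have [f simf fE] := rp i ik; have [g simg gE] := rp' i ik.
have simhf := similarity_comp simh simf.
apply: (prism_uniq _ simhf simg); first by rewrite mul1r.
by move=> u; rewrite /= -fE -gE p'E.
Qed.

(** For each copy a rigid motion carries one realization to the other.  The motions
    of consecutive copies agree at the ends of the glued edge, so they are all
    equal. *)
Lemma realizes_congruent mu s p p' : (0 < k)%N -> (forall i, 0 < mu i) ->
  realizes mu s p -> realizes mu s p' -> congruent p p'.
Proof.
move=> k0 mup rp rp'.
have local i : (i < k)%N ->
    exists2 h, similarity 1 h & forall u, p' (D i u) = h (p (D i u)).
  move=> ik; have [f simf fE] := rp i ik; have [g simg gE] := rp' i ik.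
  have [f' simf' [fK _]] := similarity_inv (mup i) simf.
  exists (g \o f'); last by move=> u; rewrite /= fE fK gE.
  by have := similarity_comp simg simf'; rewrite divff // gt_eqF.
have [h simh hE] := local 0%N k0.
exists h; first exact/rigid_motionP.
suff all_h i : (i < k)%N -> forall u, p' (D i u) = h (p (D i u)).
  by move=> x; have [i ik [u ->]] := cat_vertices cat x; exact: all_h.
elim: i => [//|i IHi] ik w.
have [h' simh' h'E] := local i.+1 ik.
have [u [v [u' [v' [uv uv' Du Dv _]]]]] := glue_ends cat ik.
rewrite h'E; apply: (similarity_uniq simh' simh (x := p (D i u)) (y := p (D i v))).
- by rewrite -edist_gt0 (realizes_edist rp) ?mulr_gt0 ?prism_len_gt0 ?ltW // ltnW.
- by rewrite -IHi ?(ltnW ik) // Du h'E.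
- by rewrite -IHi ?(ltnW ik) // Dv h'E.
Qed.

Lemma embedding_realizes mu l p : (forall i, 0 < mu i) ->
  (forall i u v, (i < k)%N -> desargues u v ->
    l (D i u) (D i v) = mu i * prism_len R u v) ->
  embedding e l p <-> exists s, realizes mu s p.
Proof.
move=> mup lE; split=> [ep|[s rp] x y].
  have : forall i, exists j, (i < k)%N ->
      exists2 f, similarity (mu i) f & forall u, p (D i u) = f (prism R j u).
    move=> i; case: (boolP (i < k)%N) => [ik|_]; last by exists (false, false, 0, false).
    have [|j [f simf fE]] := prism_complete (p := p \o D i) (mup i).
      move=> u v uv; rewrite -lE // -ep //.
      by apply/(cat_edges cat); exists i => //; exists u, v.
    by exists j => _; exists f.
  by move/choice=> [s sP]; exists s => i ik; exact: sP.
move/(cat_edges cat) => [i ik [u [v [uv -> ->]]]].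
by rewrite lE // (realizes_edist rp) // ltW.
Qed.

(** The lengths are those of one realization with the scales common to all lists
    of poses.  The class of an embedding then is the set of realizations of its
    list of poses, so classes correspond to such lists. *)
Lemma num_embeddings_caterpillar : (0 < k)%N ->
  exists l : 'I_n -> 'I_n -> R, edge_lengths e l /\ @num_embeddings R 2 n e l (24 ^ k).
Proof.
move=> k0; have [mu [mup mu_ex]] := common_ratios.
pose j0 : pose_index := (false, false, 0, false).
have [p0 rp0] := mu_ex (fun=> j0).
pose l x y := edist (p0 x) (p0 y).
have lE i u v : (i < k)%N -> desargues u v -> l (D i u) (D i v) = mu i * prism_len R u v.
  by move=> ik uv; rewrite /l (realizes_edist rp0) // ltW.
exists l; split.
  move=> x y /(cat_edges cat)[i ik [u [v [uv -> ->]]]].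
  by split; [rewrite lE // mulr_gt0 ?prism_len_gt0 | exact: edistC].
have embP p := embedding_realizes p mup lE.
pose ext (c : {ffun 'I_k -> pose_index}) i := oapp c j0 (insub i).
have extE c (i : 'I_k) : ext c i = c i by rewrite /ext valK.
pose cls (c : {ffun 'I_k -> pose_index}) : set ('I_n -> plane) :=
  [set p | realizes mu (ext c) p]%classic.
have realizes_ext s p : realizes mu s p ->
    realizes mu (ext [ffun i : 'I_k => s i]) p.
  move=> rp i ik; have [f simf fE] := rp i ik; exists f => // u.
  by rewrite (extE _ (Ordinal ik)) ffunE.
have clsE c p : realizes mu (ext c) p ->
    [set q | embedding e l q /\ congruent p q]%classic = cls c.
  move=> rp; apply/seteqP; split=> q /=.
    move=> [/embP[s rq] pq] i ik; have [f simf fE] := rq i ik.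
    by exists f => // u; rewrite (congruent_same_poses mup rp rq pq ik).
  move=> rq; split; first by apply/embP; exists (ext c).
  exact: realizes_congruent rp rq.
have cls_inj : injective cls.
  move=> c c' cc'; have [p rp] := mu_ex (ext c).
  have rp' : cls c' p by rewrite -cc'.
  apply/ffunP => i; rewrite -!extE.
  exact: (congruent_same_poses mup rp rp' (realizes_congruent k0 mup rp rp) (ltn_ord i)).
have classesE : @embedding_classes R 2 n e l =
    ((cls \o enum_val) @` [set: 'I_#|{ffun 'I_k -> pose_index}|])%classic.
  apply/seteqP; split=> X /=.
    move=> [p /= /embP[s rp] <-].
    exists (enum_rank [ffun i : 'I_k => s i]) => //=.
    by rewrite enum_rankK (clsE _ _ (realizes_ext _ _ rp)).
  move=> [i _ <-]; have [p rp] := mu_ex (ext (enum_val i)).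
  by exists p; [apply/embP; exists (ext (enum_val i)) | exact: clsE].
rewrite /num_embeddings classesE.
have <- : #|{ffun 'I_k -> pose_index}| = (24 ^ k)%N
  by rewrite card_ffun card_pose_index card_ord.
apply: card_eq_trans (card_esym card_II).
apply: inj_card_eq => i i' _ _ /cls_inj; exact: enum_val_inj.
Qed.

End Gluing.

Theorem lemma5p4 (R : realType) :
  exists c C : R,
    [/\ 0 < c, 0 < C &
      forall (k n : nat) (e : rel 'I_n),
        (1 <= k)%N -> caterpillar k e ->
        n = (4 * k + 2)%N /\
        exists (l : 'I_n -> 'I_n -> R) (N : nat),
          [/\ edge_lengths e l,
              num_embeddings 2 e l N &
              c * 24 `^ (n%:R / 4) <= N%:R <= C * 24 `^ (n%:R / 4)]].
Proof.
have pos : 0 < (24 `^ (1 / 2))^-1 :> R by rewrite invr_gt0 powR_gt0.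
exists (24 `^ (1 / 2))^-1, (24 `^ (1 / 2))^-1; split=> // k n e k0 [D [m [S cat]]].
have nE := caterpillar_order cat k0; split=> //.
have [l [lpos lnum]] := num_embeddings_caterpillar R cat k0.
exists l, (24 ^ k)%N; split=> //.
suff -> : (24 ^ k)%N%:R = (24 `^ (1 / 2))^-1 * 24 `^ (n%:R / 4) :> R by rewrite lexx.
have -> : n%:R / 4 = 1 / 2 + k%:R :> R by rewrite nE natrD natrM; field.
rewrite powRD; last by apply/implyP => _; rewrite pnatr_eq0.
by rewrite mulKf ?gt_eqF ?powR_gt0 // powR_mulrn // natrX.
Qed.
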